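(* Let $\mathbb{G}$ be a Lie 2-group, $(\pi:\mathbb{E}\to\mathbb{X},\mathcal{C})$ a quasi-principal $\mathbb{G}$-bundle over a Lie groupoid $\mathbb{X}$, and suppose there is a left action of $\mathbb{G}$ on a 2-vector space $\mathbb{V}$. Then the associated VB-groupoid $\pi^{\mathbb{V}}:\frac{\mathbb{E}\times\mathbb{V}}{\mathbb{G}}\to\mathbb{X}$ admits a linear cleavage $$\mathcal{C}^{\mathbb{V}}:X_1\times_{s,X_0,\pi_0^{\mathbb{V}}}\frac{E_0\times V_0}{G_0}\to\frac{E_1\times V_1}{G_1},\qquad(\gamma,[p,v])\mapsto[\mathcal{C}(\gamma,p),1_v].$$ Moreover, if $\mathcal{C}$ is unital then so is $\mathcal{C}^{\mathbb{V}}$, and if $\mathcal{C}$ is a categorical connection then $\mathcal{C}^{\mathbb{V}}$ is flat.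
   Context: In a Lie groupoid $\mathbb{X}=[X_1\rightrightarrows X_0]$ the source and target are $s,t$, the unit is $x\mapsto 1_x$, and $\gamma_2\circ\gamma_1$ is defined when $t(\gamma_1)=s(\gamma_2)$. Morphisms of Lie groupoids are smooth functors. A (strict) Lie 2-group $\mathbb{G}=[G_1\rightrightarrows G_0]$ is a Lie groupoid with a smooth functor $\mathbb{G}\times\mathbb{G}\to\mathbb{G}$ giving Lie group structures on $G_0$ and $G_1$. A principal $\mathbb{G}$-bundle over $\mathbb{X}$ is a morphism of Lie groupoids $\pi:\mathbb{E}=[E_1\rightrightarrows E_0]\to\mathbb{X}$ with a right action of $\mathbb{G}$ on $\mathbb{E}$ (a smooth functor $\mathbb{E}\times\mathbb{G}\to\mathbb{E}$, a Lie group action on objects and on morphisms) such that $\pi_0:E_0\to X_0$ and $\pi_1:E_1\to X_1$ are principal $G_0$- and $G_1$-bundles. A quasi connection is a smooth map $\mathcal{C}:s^*E_0=X_1\times_{s,X_0,\pi_0}E_0\to E_1$ with $s(\mathcal{C}(\gamma,p))=p$, $\pi_1(\mathcal{C}(\gamma,p))=\gamma$ and $\mathcal{C}(\gamma,pg)=\mathcal{C}(\gamma,p)1_g$; $(\pi,\mathcal{C})$ is then a quasi-principal $\mathbb{G}$-bundle. $\mathcal{C}$ is unital if $\mathcal{C}(1_{\pi(p)},p)=1_p$ for all $p\in E_0$. It is a categorical connection if it is unital and $\mathcal{C}(\gamma_2\circ\gamma_1,p_1)=\mathcal{C}(\gamma_2,p_2)\circ\mathcal{C}(\gamma_1,p_1)$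 whenever $s(\gamma_2)=t(\gamma_1)$ and $p_2=t(\mathcal{C}(\gamma_1,p_1))$. A 2-vector space $\mathbb{V}=[V_1\rightrightarrows V_0]$ is a category internal to finite-dimensional real vector spaces. A left action of $\mathbb{G}$ on $\mathbb{V}$ is a functor $\rho:\mathbb{G}\times\mathbb{V}\to\mathbb{V}$ such that $\rho_i:G_i\times V_i\to V_i$ are left Lie group actions inducing linear representations of $G_i$ on $V_i$, $i=0,1$. A VB-groupoid over $\mathbb{X}$ is a morphism of Lie groupoids $\pi:\mathbb{D}=[D_1\rightrightarrows D_0]\to\mathbb{X}$ such that $\pi_1:D_1\to X_1$ and $\pi_0:D_0\to X_0$ are vector bundles, the source and target maps of $\mathbb{D}$ are vector bundle morphisms over those of $\mathbb{X}$, and $(\gamma_3\circ\gamma_1)+(\gamma_4\circ\gamma_2)=(\gamma_3+\gamma_4)\circ(\gamma_1+\gamma_2)$ whenever this makes sense. A (linear) cleavage on it is a smooth section $\mathcal{C}$ of $D_1\to X_1\times_{s,X_0,\pi_0}D_0$, $\delta\mapsto(\pi_1(\delta),s(\delta))$, which is a morphism of vector bundles. It is unital if $\mathcal{C}(1_{\pi(p)},p)=1_p$ for all $p\in D_0$, and flat if $\mathcal{C}(\gamma_2\circ\gamma_1,p_1)=\mathcal{C}(\gamma_2,p_2)\circ\mathcal{C}(\gamma_1,p_1)$ whenever $s(\gamma_2)=t(\gamma_1)$ and $p_2=t(\mathcal{C}(\gamma_1,p_1))$. The associated VB-groupoid is $\frac{\mathbb{E}\times\mathbb{V}}{\mathbb{G}}=\left[\frac{E_1\times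 V_1}{G_1}\rightrightarrows\frac{E_0\times V_0}{G_0}\right]$, where $\frac{E_i\times V_i}{G_i}$ is the usual associated vector bundle (quotient of $E_i\times V_i$ by $(p,v)\sim(pg,g^{-1}v)$, $g\in G_i$). Its structure maps are induced by those of $\mathbb{E}$ and $\mathbb{V}$ (e.g. $s[\delta,\zeta]=[s(\delta),s(\zeta)]$), and its projection is $\pi_i^{\mathbb{V}}([p,v])=\pi_i(p)$. *)

(* Defs.v *)
From HB Require Import structures.
From mathcomp Require Import all_boot all_order all_algebra.
From mathcomp Require Import all_classical all_reals all_analysis.
Import Order.TTheory GRing.Theory Num.Theory.
Import numFieldNormedType.Exports.
Import VectorInternalTheory.

Set Implicit Arguments.
Unset Strict Implicit.
Unset Printing Implicit Defensive.

Local Open Scope classical_set_scope.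
Local Open Scope ring_scope.

(** * Smooth manifolds *)

Fixpoint Ck (R : realType) (U W : normedModType R) (k : nat)
    (O : set U) (F : U -> W) : Prop :=
  match k with
  | 0%N => forall x, O x -> {for x, continuous F}
  | k'.+1 => (forall x, O x -> differentiable F x) /\
             (forall v : U, Ck k' O (fun x => 'D_v F x))
  end.

Definition Cinfty (R : realType) (U W : normedModType R)
    (O : set U) (F : U -> W) : Prop :=
  forall k, Ck k O F.

(* As in do Carmo's _Riemannian Geometry_, a chart is a local parametrization,
   i.e. it goes from a subset of R^n to the manifold, and the topology of a
   manifold is read off from its charts. *)
Record chart (R : realType) (T : Type) := Chart {
  cdim : nat;
  cdom : set 'rV[R]_cdim;
  cmap : 'rV[R]_cdim -> T }.

Arguments cdom {R T} c _.
Arguments cmap {R T} c _.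

Record smoothSpace (R : realType) := SmoothSpace {
  carrier :> Type;
  charts : set (chart R carrier) }.

(* F expresses, near the coordinates a, the restriction of f to A. *)
Definition local_rep (R : realType) (M N : smoothSpace R) (A : set M)
    (f : M -> N) (c : chart R M) (d : chart R N)
    (a : 'rV[R]_(cdim c)) (F : 'rV[R]_(cdim c) -> 'rV[R]_(cdim d)) : Prop :=
  exists O : set 'rV[R]_(cdim c),
    [/\ open O, O a, Cinfty O F &
        forall b, O b -> cdom c b -> A (cmap c b) ->
          cdom d (F b) /\ cmap d (F b) = f (cmap c b)].

Arguments local_rep {R M N} A f c d a F.

(* A map between manifolds, given on a subset A only (e.g. an open subset or a
   fibre product), is smooth when it has smooth local extensions; for an
   embedded submanifold A this is smoothness for its manifold structure.  The
   values of f outside of A are irrelevant. *)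
Definition smooth_on (R : realType) (M N : smoothSpace R) (A : set M)
    (f : M -> N) : Prop :=
  forall x, A x -> exists (c : chart R M) (d : chart R N) a F,
    [/\ charts c, charts d, cdom c a, cmap c a = x & local_rep A f c d a F].

Definition smooth (R : realType) (M N : smoothSpace R) (f : M -> N) : Prop :=
  smooth_on setT f.

Definition submersion (R : realType) (M N : smoothSpace R) (f : M -> N) : Prop :=
  forall x, exists (c : chart R M) (d : chart R N) a F,
    [/\ charts c /\ charts d, cdom c a, cmap c a = x,
        local_rep setT f c d a F &
        forall w, exists v, 'd F a v = w].

Definition mopen (R : realType) (M : smoothSpace R) (A : set M) : Prop :=
  forall c : chart R M, charts c -> open [set a | cdom c a /\ A (cmap c a)].

Record is_manifold (R : realType) (M : smoothSpace R) : Prop := {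
  mfd_open : forall c : chart R M, charts c -> open (cdom c);
  mfd_inj : forall c : chart R M, charts c -> 
    forall a b, cdom c a -> cdom c b -> cmap c a = cmap c b -> a = b;
  mfd_cover : forall x : M, exists (c : chart R M) a,
    [/\ charts c, cdom c a & cmap c a = x];
  mfd_compat : forall (c d : chart R M) a b, charts c -> charts d ->
    cdom c a -> cdom d b -> cmap c a = cmap d b ->
    exists F, local_rep setT id c d a F;
  mfd_hausdorff : forall x y : M, x <> y ->
    exists A B : set M, [/\ mopen A, mopen B, A x, B y & A `&` B = set0];
  mfd_second_countable : exists B : nat -> set M,
    (forall k, mopen (B k)) /\
    (forall (A : set M) x, mopen A -> A x -> exists k, B k x /\ B k `<=` A) }.

Definition prodChart (R : realType) (S T : Type) (c : chart R S) (d : chart R T)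
    : chart R (S * T) :=
  @Chart R (S * T) (cdim c + cdim d)
    [set w | cdom c (lsubmx w) /\ cdom d (rsubmx w)]
    (fun w => (cmap c (lsubmx w), cmap d (rsubmx w))).

Definition prodSpace (R : realType) (M N : smoothSpace R) : smoothSpace R :=
  @SmoothSpace R (M * N)%type
    [set e | exists (c : chart R M) (d : chart R N),
       [/\ charts c, charts d & e = prodChart c d]].

(* r2v is the linear coordinate system 'rV_(dim V) -> V of the library. *)
Definition vectSpace (R : realType) (V : vectType R) : smoothSpace R :=
  @SmoothSpace R V [set @Chart R V (dim V) setT (@r2v R V)].

Record lieGroup (R : realType) := LieGroup {
  lgr_space :> smoothSpace R;
  lgr_mul : lgr_space -> lgr_space -> lgr_space;
  lgr_one : lgr_space;
  lgr_inv : lgr_space -> lgr_space;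
  lgr_manifold : is_manifold lgr_space;
  lgr_mulA : associative lgr_mul;
  lgr_mul1 : left_id lgr_one lgr_mul;
  lgr_mulV : left_inverse lgr_one lgr_inv lgr_mul;
  lgr_mul_smooth :
    @smooth R (prodSpace lgr_space lgr_space) lgr_space (fun p => lgr_mul p.1 p.2);
  lgr_inv_smooth : smooth lgr_inv }.

(** * Lie groupoids *)

(* comp g f is meaningful when tgt f = src g. *)
Record smcat (R : realType) := Smcat {
  Ob : smoothSpace R;
  Ar : smoothSpace R;
  src : Ar -> Ob;
  tgt : Ar -> Ob;
  idar : Ob -> Ar;
  comp : Ar -> Ar -> Ar }.

Record is_category (R : realType) (X : smcat R) : Prop := {
  cat_src_id : forall x : Ob X, src (idar x) = x;
  cat_tgt_id : forall x : Ob X, tgt (idar x) = x;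
  cat_src_comp : forall g f : Ar X, tgt f = src g -> src (comp g f) = src f;
  cat_tgt_comp : forall g f : Ar X, tgt f = src g -> tgt (comp g f) = tgt g;
  cat_comp_id : forall f : Ar X, comp f (idar (src f)) = f;
  cat_id_comp : forall f : Ar X, comp (idar (tgt f)) f = f;
  cat_compA : forall h g f : Ar X, tgt f = src g -> tgt g = src h ->
    comp h (comp g f) = comp (comp h g) f }.

Record is_lie_groupoid (R : realType) (X : smcat R) : Prop := {
  lgd_ob : is_manifold (Ob X);
  lgd_ar : is_manifold (Ar X);
  lgd_cat : is_category X;
  lgd_src : submersion (@src R X);
  lgd_tgt : submersion (@tgt R X);
  lgd_id : smooth (@idar R X);
  lgd_comp : @smooth_on R (prodSpace (Ar X) (Ar X)) (Ar X)
    [set p | tgt p.2 = src p.1] (fun p => comp p.1 p.2);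
  lgd_inv : exists inv : Ar X -> Ar X, smooth inv /\
    forall f, [/\ src (inv f) = tgt f, tgt (inv f) = src f,
                  comp (inv f) f = idar (src f) & comp f (inv f) = idar (tgt f)] }.

Record lieGroupoid (R : realType) := LieGroupoid {
  lgd_smcat :> smcat R;
  lgd_ax : is_lie_groupoid lgd_smcat }.

Record smooth_functor (R : realType) (X Y : smcat R)
    (F0 : Ob X -> Ob Y) (F1 : Ar X -> Ar Y) : Prop := {
  fun_smooth0 : smooth F0;
  fun_smooth1 : smooth F1;
  fun_src : forall f, src (F1 f) = F0 (src f);
  fun_tgt : forall f, tgt (F1 f) = F0 (tgt f);
  fun_id : forall x, F1 (idar x) = idar (F0 x);
  fun_comp : forall g f, tgt f = src g -> F1 (comp g f) = comp (F1 g) (F1 f) }.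

Definition prodCat (R : realType) (X Y : smcat R) : smcat R :=
  @Smcat R (prodSpace (Ob X) (Ob Y)) (prodSpace (Ar X) (Ar Y))
    (fun f => (src f.1, src f.2)) (fun f => (tgt f.1, tgt f.2))
    (fun x => (idar x.1, idar x.2)) (fun g f => (comp g.1 f.1, comp g.2 f.2)).

Record lie2Group (R : realType) := Lie2Group {
  l2g_gpd :> lieGroupoid R;
  l2g_mul0 : Ob l2g_gpd -> Ob l2g_gpd -> Ob l2g_gpd;
  l2g_mul1 : Ar l2g_gpd -> Ar l2g_gpd -> Ar l2g_gpd;
  l2g_functor : @smooth_functor R (prodCat l2g_gpd l2g_gpd) l2g_gpd
    (fun p => l2g_mul0 p.1 p.2) (fun p => l2g_mul1 p.1 p.2);
  l2g_one0 : Ob l2g_gpd;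
  l2g_inv0 : Ob l2g_gpd -> Ob l2g_gpd;
  l2g_mulA0 : associative l2g_mul0;
  l2g_mul10 : left_id l2g_one0 l2g_mul0;
  l2g_mulV0 : left_inverse l2g_one0 l2g_inv0 l2g_mul0;
  l2g_inv_smooth0 : smooth l2g_inv0;
  l2g_one1 : Ar l2g_gpd;
  l2g_inv1 : Ar l2g_gpd -> Ar l2g_gpd;
  l2g_mulA1 : associative l2g_mul1;
  l2g_mul11 : left_id l2g_one1 l2g_mul1;
  l2g_mulV1 : left_inverse l2g_one1 l2g_inv1 l2g_mul1;
  l2g_inv_smooth1 : smooth l2g_inv1 }.

Definition G0 (R : realType) (G : lie2Group R) : lieGroup R :=
  @LieGroup R (Ob G) (@l2g_mul0 R G) (@l2g_one0 R G) (@l2g_inv0 R G)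
    (lgd_ob (lgd_ax G)) (@l2g_mulA0 R G) (@l2g_mul10 R G) (@l2g_mulV0 R G)
    (fun_smooth0 (l2g_functor G)) (@l2g_inv_smooth0 R G).

Definition G1 (R : realType) (G : lie2Group R) : lieGroup R :=
  @LieGroup R (Ar G) (@l2g_mul1 R G) (@l2g_one1 R G) (@l2g_inv1 R G)
    (lgd_ar (lgd_ax G)) (@l2g_mulA1 R G) (@l2g_mul11 R G) (@l2g_mulV1 R G)
    (fun_smooth1 (l2g_functor G)) (@l2g_inv_smooth1 R G).

(** * Principal 2-bundles and quasi connections *)

Record principal_bundle (R : realType) (G : lieGroup R) (P M : smoothSpace R)
    (pr : P -> M) (act : P -> G -> P) : Prop := {
  pb_pr_smooth : smooth pr;
  pb_act_smooth : @smooth R (prodSpace P G) P (fun u => act u.1 u.2);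
  pb_act1 : forall p, act p (lgr_one G) = p;
  pb_actM : forall p g h, act p (lgr_mul g h) = act (act p g) h;
  pb_pr_act : forall p g, pr (act p g) = pr p;
  pb_triv : forall x : M, exists (U : set M) (Phi : M * G -> P) (Psi : P -> M * G),
    [/\ mopen U /\ U x,
        @smooth_on R (prodSpace M G) P [set u | U u.1] Phi /\
        @smooth_on R P (prodSpace M G) [set p | U (pr p)] Psi,
        forall y g, U y -> Psi (Phi (y, g)) = (y, g),
        forall p, U (pr p) -> (Psi p).1 = pr p /\ Phi (Psi p) = p &
        forall y g h, U y -> pr (Phi (y, g)) = y /\
          Phi (y, lgr_mul g h) = act (Phi (y, g)) h] }.

Record principal2Bundle (R : realType) (G : lie2Group R) (X : lieGroupoid R) :=
  Principal2Bundle {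
  p2b_tot :> lieGroupoid R;
  pr0 : Ob p2b_tot -> Ob X;
  pr1 : Ar p2b_tot -> Ar X;
  act0 : Ob p2b_tot -> G0 G -> Ob p2b_tot;
  act1 : Ar p2b_tot -> G1 G -> Ar p2b_tot;
  p2b_pr_functor : smooth_functor pr0 pr1;
  p2b_act_functor : @smooth_functor R (prodCat p2b_tot G) p2b_tot
    (fun u => act0 u.1 u.2) (fun u => act1 u.1 u.2);
  p2b_principal0 : principal_bundle pr0 act0;
  p2b_principal1 : principal_bundle pr1 act1 }.

Record quasi_connection (R : realType) (G : lie2Group R) (X : lieGroupoid R)
    (E : principal2Bundle G X) (C : Ar X -> Ob E -> Ar E) : Prop := {
  qc_smooth : @smooth_on R (prodSpace (Ar X) (Ob E)) (Ar E)
    [set u | src u.1 = pr0 u.2] (fun u => C u.1 u.2);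
  qc_src : forall gamma p, src gamma = pr0 p -> src (C gamma p) = p;
  qc_pr : forall gamma p, src gamma = pr0 p -> pr1 (C gamma p) = gamma;
  qc_act : forall gamma p (g : Ob G), src gamma = pr0 p ->
    C gamma (act0 p g) = act1 (C gamma p) (idar g) }.

Definition unital_connection (R : realType) (G : lie2Group R) (X : lieGroupoid R)
    (E : principal2Bundle G X) (C : Ar X -> Ob E -> Ar E) : Prop :=
  forall p : Ob E, C (idar (pr0 p)) p = idar p.

Definition categorical_connection (R : realType) (G : lie2Group R)
    (X : lieGroupoid R) (E : principal2Bundle G X)
    (C : Ar X -> Ob E -> Ar E) : Prop :=
  unital_connection C /\
  forall (gamma1 gamma2 : Ar X) (p1 p2 : Ob E),
    src gamma1 = pr0 p1 -> tgt gamma1 = src gamma2 -> p2 = tgt (C gamma1 p1) ->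
    C (comp gamma2 gamma1) p1 = comp (C gamma2 p2) (C gamma1 p1).

(** * 2-vector spaces *)

Record twoVectorSpace (R : realType) := TwoVectorSpace {
  V0 : vectType R;
  V1 : vectType R;
  vsrc : {linear V1 -> V0};
  vtgt : {linear V1 -> V0};
  vid : {linear V0 -> V1};
  vcomp : V1 -> V1 -> V1;
  vcat :> smcat R := @Smcat R (vectSpace V0) (vectSpace V1) vsrc vtgt vid vcomp;
  vcat_ax : is_category vcat;
  vcomp_linear : forall (a : R) (g g' f f' : V1),
    vtgt f = vsrc g -> vtgt f' = vsrc g' ->
    vcomp (a *: g + g') (a *: f + f') = a *: vcomp g f + vcomp g' f' }.

Record linear_rep (R : realType) (G : lieGroup R) (V : vectType R)
    (rho : G -> V -> V) : Prop := {
  rep_smooth :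
    @smooth R (prodSpace G (vectSpace V)) (vectSpace V) (fun u => rho u.1 u.2);
  rep_one : forall v, rho (lgr_one G) v = v;
  rep_mul : forall g h v, rho (lgr_mul g h) v = rho g (rho h v);
  rep_linear : forall g, linear (rho g) }.

Record left_action (R : realType) (G : lie2Group R) (V : twoVectorSpace R) :=
  LeftAction {
  rho0 : G0 G -> V0 V -> V0 V;
  rho1 : G1 G -> V1 V -> V1 V;
  rho_functor : @smooth_functor R (prodCat G V) V
    (fun u => rho0 u.1 u.2) (fun u => rho1 u.1 u.2);
  rho_rep0 : linear_rep rho0;
  rho_rep1 : linear_rep rho1 }.

(** * VB-groupoids and cleavages *)

(* Addition and scaling are meaningful within the fibres of pr.  The
   trivializations are linear isomorphisms on the fibres, so that these are
   vector spaces. *)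
Record vector_bundle (R : realType) (D M : smoothSpace R) (pr : D -> M)
    (add : D -> D -> D) (scale : R -> D -> D) : Prop := {
  vb_pr_smooth : smooth pr;
  vb_triv : forall x : M, exists (U : set M) (W : vectType R)
      (Phi : M * W -> D) (Psi : D -> M * W),
    [/\ mopen U /\ U x,
        @smooth_on R (prodSpace M (vectSpace W)) D [set u | U u.1] Phi /\
        @smooth_on R D (prodSpace M (vectSpace W)) [set d | U (pr d)] Psi,
        forall y w, U y -> Psi (Phi (y, w)) = (y, w),
        forall d, U (pr d) -> (Psi d).1 = pr d /\ Phi (Psi d) = d &
        forall y, U y -> [/\ forall w, pr (Phi (y, w)) = y,
          forall w w', Phi (y, w + w') = add (Phi (y, w)) (Phi (y, w')) &
          forall a w, Phi (y, a *: w) = scale a (Phi (y, w))]] }.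

Record vbGroupoidData (R : realType) (X : lieGroupoid R) := VBGroupoidData {
  vb_cat :> smcat R;
  vb_pr0 : Ob vb_cat -> Ob X;
  vb_pr1 : Ar vb_cat -> Ar X;
  add0 : Ob vb_cat -> Ob vb_cat -> Ob vb_cat;
  scale0 : R -> Ob vb_cat -> Ob vb_cat;
  add1 : Ar vb_cat -> Ar vb_cat -> Ar vb_cat;
  scale1 : R -> Ar vb_cat -> Ar vb_cat }.

Record is_vb_groupoid (R : realType) (X : lieGroupoid R)
    (D : vbGroupoidData X) : Prop := {
  vbg_gpd : is_lie_groupoid D;
  vbg_pr : smooth_functor (@vb_pr0 R X D) (@vb_pr1 R X D);
  vbg_bundle0 : vector_bundle (@vb_pr0 R X D) (@add0 R X D) (@scale0 R X D);
  vbg_bundle1 : vector_bundle (@vb_pr1 R X D) (@add1 R X D) (@scale1 R X D);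
  vbg_src_add : forall d e : Ar D, vb_pr1 d = vb_pr1 e ->
    src (add1 d e) = add0 (src d) (src e);
  vbg_tgt_add : forall d e : Ar D, vb_pr1 d = vb_pr1 e ->
    tgt (add1 d e) = add0 (tgt d) (tgt e);
  vbg_src_scale : forall (a : R) (d : Ar D), src (scale1 a d) = scale0 a (src d);
  vbg_tgt_scale : forall (a : R) (d : Ar D), tgt (scale1 a d) = scale0 a (tgt d);
  vbg_interchange : forall d1 d2 d3 d4 : Ar D,
    tgt d1 = src d3 -> tgt d2 = src d4 ->
    vb_pr1 d1 = vb_pr1 d2 -> vb_pr1 d3 = vb_pr1 d4 ->
    add1 (comp d3 d1) (comp d4 d2) = comp (add1 d3 d4) (add1 d1 d2) }.

Record linear_cleavage (R : realType) (X : lieGroupoid R)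
    (D : vbGroupoidData X) (C : Ar X -> Ob D -> Ar D) : Prop := {
  cl_smooth : @smooth_on R (prodSpace (Ar X) (Ob D)) (Ar D)
    [set u | src u.1 = vb_pr0 u.2] (fun u => C u.1 u.2);
  cl_pr : forall gamma p, src gamma = vb_pr0 p -> vb_pr1 (C gamma p) = gamma;
  cl_src : forall gamma p, src gamma = vb_pr0 p -> src (C gamma p) = p;
  cl_add : forall gamma p q, src gamma = vb_pr0 p -> src gamma = vb_pr0 q ->
    C gamma (add0 p q) = add1 (C gamma p) (C gamma q);
  cl_scale : forall gamma (a : R) p, src gamma = vb_pr0 p ->
    C gamma (scale0 a p) = scale1 a (C gamma p) }.

Definition unital_cleavage (R : realType) (X : lieGroupoid R)
    (D : vbGroupoidData X) (C : Ar X -> Ob D -> Ar D) : Prop :=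
  forall p : Ob D, C (idar (vb_pr0 p)) p = idar p.

Definition flat_cleavage (R : realType) (X : lieGroupoid R)
    (D : vbGroupoidData X) (C : Ar X -> Ob D -> Ar D) : Prop :=
  forall (gamma1 gamma2 : Ar X) (p1 p2 : Ob D),
    src gamma1 = vb_pr0 p1 -> tgt gamma1 = src gamma2 -> p2 = tgt (C gamma1 p1) ->
    C (comp gamma2 gamma1) p1 = comp (C gamma2 p2) (C gamma1 p1).

(** * The associated VB-groupoid *)

Definition assocOrbit (R : realType) (G : lieGroup R) (P : smoothSpace R)
    (act : P -> G -> P) (V : vectType R) (rho : G -> V -> V) (u : P * V)
    : set (P * V) :=
  [set w | exists g, w = (act u.1 g, rho (lgr_inv g) u.2)].

Definition assocCarrier (R : realType) (G : lieGroup R) (P : smoothSpace R)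
    (act : P -> G -> P) (V : vectType R) (rho : G -> V -> V) : Type :=
  {O : set (P * V) | exists u, O = assocOrbit act rho u}.

Definition cls (R : realType) (G : lieGroup R) (P : smoothSpace R)
    (act : P -> G -> P) (V : vectType R) (rho : G -> V -> V) (p : P) (v : V)
    : assocCarrier act rho :=
  exist _ (assocOrbit act rho (p, v)) (ex_intro _ (p, v) erefl).

(* The chart attached to a chart c of M and a smooth local section sigma of P
   over the open set U: in the associated bundle, (x, v) |-> [sigma x, v] is a
   trivialization over U. *)
Definition assocChart (R : realType) (G : lieGroup R) (P M : smoothSpace R)
    (act : P -> G -> P) (V : vectType R) (rho : G -> V -> V)
    (c : chart R M) (U : set M) (sigma : M -> P)
    : chart R (assocCarrier act rho) :=
  @Chart R (assocCarrier act rho) (cdim c + dim V)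
    [set w | cdom c (lsubmx w) /\ U (cmap c (lsubmx w))]
    (fun w => cls act rho (sigma (cmap c (lsubmx w)))
                          (r2v (rsubmx w : 'rV_(dim V)))).

Definition assocSpace (R : realType) (G : lieGroup R) (P M : smoothSpace R)
    (pr : P -> M) (act : P -> G -> P) (V : vectType R) (rho : G -> V -> V)
    : smoothSpace R :=
  @SmoothSpace R (assocCarrier act rho)
    [set e | exists (c : chart R M) (U : set M) (sigma : M -> P),
       [/\ charts c, mopen U, smooth_on U sigma, forall x, U x -> pr (sigma x) = x &
           e = assocChart act rho c U sigma]].

Definition rep (R : realType) (G : lieGroup R) (P : smoothSpace R)
    (act : P -> G -> P) (V : vectType R) (rho : G -> V -> V)
    (d : assocCarrier act rho) : P * V :=
  projT1 (cid (proj2_sig d)).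

(* An element satisfying Q if there is one, x0 otherwise. *)
Definition choice_of (T : Type) (x0 : T) (Q : T -> Prop) : T :=
  if pselect (exists x, Q x) is left h then projT1 (cid h) else x0.

Definition assocAdd (R : realType) (G : lieGroup R) (P : smoothSpace R)
    (act : P -> G -> P) (V : vectType R) (rho : G -> V -> V)
    (d e : assocCarrier act rho) : assocCarrier act rho :=
  choice_of d (fun s => exists p v w,
    [/\ d = cls act rho p v, e = cls act rho p w & s = cls act rho p (v + w)]).

Definition assocScale (R : realType) (G : lieGroup R) (P : smoothSpace R)
    (act : P -> G -> P) (V : vectType R) (rho : G -> V -> V)
    (a : R) (d : assocCarrier act rho) : assocCarrier act rho :=
  cls act rho (rep d).1 (a *: (rep d).2).

Definition assocCat (R : realType) (G : lie2Group R) (X : lieGroupoid R)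
    (E : principal2Bundle G X) (V : twoVectorSpace R) (rho : left_action G V)
    : smcat R :=
  @Smcat R
    (assocSpace (@pr0 R G X E) (@act0 R G X E) (@rho0 R G V rho))
    (assocSpace (@pr1 R G X E) (@act1 R G X E) (@rho1 R G V rho))
    (fun d => cls _ _ (src (rep d).1) (vsrc V (rep d).2))
    (fun d => cls _ _ (tgt (rep d).1) (vtgt V (rep d).2))
    (fun x => cls _ _ (idar (rep x).1) (vid V (rep x).2))
    (fun d2 d1 => choice_of d1 (fun d => exists delta2 zeta2 delta1 zeta1,
       [/\ d2 = cls _ _ delta2 zeta2 /\ d1 = cls _ _ delta1 zeta1,
           tgt delta1 = src delta2, vtgt V zeta1 = vsrc V zeta2 &
           d = cls _ _ (comp delta2 delta1) (vcomp zeta2 zeta1)])).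

Definition assocVB (R : realType) (G : lie2Group R) (X : lieGroupoid R)
    (E : principal2Bundle G X) (V : twoVectorSpace R) (rho : left_action G V)
    : vbGroupoidData X :=
  @VBGroupoidData R X (assocCat E rho)
    (fun d => pr0 (rep d).1) (fun d => pr1 (rep d).1)
    (@assocAdd _ _ _ _ _ _) (@assocScale _ _ _ _ _ _)
    (@assocAdd _ _ _ _ _ _) (@assocScale _ _ _ _ _ _).

(* Main.v *)
Require Import Defs.
From HB Require Import structures.
From mathcomp Require Import all_boot all_algebra all_classical all_reals.
From mathcomp Require Import all_analysis.
Import GRing.Theory.
Import numFieldNormedType.Exports.
Import VectorInternalTheory.

(** The formula (gamma, [p, v]) |-> [C (gamma, p), 1_v] does not depend on the
    representative: moving (p, v) to (p g, g^-1 v) changes C (gamma, p) into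
    C (gamma, p) 1_g and 1_v into 1_g^-1 1_v, because C is equivariant and the
    action of the 2-group on the 2-vector space preserves units.  It may
    therefore be computed on any representative ([assocC_cls]), and so may all
    the structure maps of the associated VB-groupoid ([src_cls], [tgt_cls],
    [idar_cls], [comp_cls], [add0_cls], ...).  The sum and the composite are
    defined by relations between classes; that these determine the result rests
    on the freeness of the principal actions ([principal_free]).  Once everything is expressed
    on representatives, the projection, source, linearity, unit and flatness
    conditions of the cleavage are the corresponding properties of C, together
    with the linearity of v |-> 1_v and 1_v o 1_v = 1_v.

    Smoothness is local ([assocC_smooth]).  Near (gamma, d), choose local
    sections sigma0 of E_0 and sigma1 of E_1; they trivialize the two associated
    bundles.  For gamma' over x, write C (gamma', sigma0 x) =
    sigma1 gamma' . h (gamma', x), where h is smooth as the group component of a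
    local trivialization of E_1.  Then
      [sigma0 x, w] |-> [sigma1 gamma' . h, 1_w] = [sigma1 gamma', h 1_w],
    so that in these trivializations the cleavage is the map
    (gamma', x, w) |-> (gamma', h (gamma', x) 1_w), which is a composite of
    smooth maps.  This requires that smooth maps given on a subset of a manifold
    can be composed and paired ([smooth_on_comp], [smooth_on_pair]), which comes
    down to the chain rule for C^k maps ([Ck_comp]) and to changes of charts. *)

Set Implicit Arguments.
Unset Strict Implicit.
Unset Printing Implicit Defensive.

Local Open Scope classical_set_scope.
Local Open Scope ring_scope.

(** * Calculus of C^k maps *)

(** Differentiability depends on the germ only: the first order expansion of F
    at x is one of G. *)
Lemma near_differentiable (R : numFieldType) (U W : normedModType R)
    (F G : U -> W) (x : U) :
  {near x, F =1 G} -> differentiable F x -> differentiable G x.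
Proof.
move=> FG dF; have [cdF eF] := (diff_locallyP _ _).1 dF.
have FGx : F x = G x := nbhs_singleton FG.
have eG : G \o shift x = cst (G x) + 'd F x +o_ 0 id.
  apply/eqaddoP => e e0; move/eqaddoP: eF => /(_ e e0) eF.
  have FG0 : \forall h \near 0, F (h + x) = G (h + x).
    by move: FG; rewrite (near_shift 0 x)/= subr0.
  near=> h; have -> : (G \o shift x - (cst (G x) + 'd F x)) h =
     (F \o shift x - (cst (F x) + 'd F x)) h.
    by rewrite /= fctE /= /cst -FGx -(near FG0 h).
  by near: h.
have dGE := diff_unique cdF eG.
by apply/diff_locallyP; rewrite dGE; split.
Unshelve. all: by end_near. Qed.

Section Ck_calculus.
Variable R : realType.
Implicit Types U W : normedModType R.

(** On an open set, Ck depends on the restriction of the function only; this is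
    what allows computing derivatives by rules that hold on that set. *)
Lemma Ck_ext U W (O : set U) k (F G : U -> W) :
  open O -> {in O, F =1 G} -> Ck k O F -> Ck k O G.
Proof.
move=> Oo; elim: k F G => [|k IH] F G FG /=.
  move=> cF x Ox; have FGx : \forall y \near x, F y = G y.
    by near=> y; apply: FG; rewrite inE; near: y; exact: open_nbhs_nbhs.
  rewrite /prop_for /continuous_at -(FG x) ?inE//.
  by apply: cvg_trans (cF x Ox); exact: near_eq_cvg.
have FGx x : O x -> \forall y \near x, F y = G y.
  by move=> Ox; near=> y; apply: FG; rewrite inE; near: y; exact: open_nbhs_nbhs.
move=> [dF DF]; split=> [x Ox|v].
  exact: near_differentiable (FGx x Ox) (dF x Ox).
apply: IH (DF v) => x; rewrite inE => Ox.
exact: near_eq_derive (FGx x Ox).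
Unshelve. all: by end_near. Qed.

Lemma CkW U W (O : set U) k (F : U -> W) : Ck k.+1 O F -> Ck k O F.
Proof.
elim: k F => [|k IH] F [dF DF].
  by move=> x Ox; exact: differentiable_continuous (dF x Ox).
by split=> // v; apply: IH; exact: DF.
Qed.

Lemma Ck_sub U W (O O' : set U) k (F : U -> W) : O' `<=` O -> Ck k O F -> Ck k O' F.
Proof.
move=> OO; elim: k F => [|k IH] F /=; first by move=> cF x /OO; exact: cF.
by move=> [dF DF]; split=> [x /OO|v]; [exact: dF|exact: IH (DF v)].
Qed.

Lemma Ck_cst U W (O : set U) k (w : W) : Ck k O (fun=> w).
Proof.
elim: k w => [|k IH] w /=; first by move=> x _; exact: cvg_cst.
split=> // v; rewrite (_ : 'D_v _ = (fun=> 0)); first exact: IH.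
by rewrite funeqE => x; exact: derive_cst.
Qed.

Lemma CkD U W (O : set U) k (F G : U -> W) :
  open O -> Ck k O F -> Ck k O G -> Ck k O (fun x => F x + G x).
Proof.
move=> Oo; elim: k F G => [|k IH] F G /=.
  by move=> cF cG x Ox; apply: continuousD; [exact: cF|exact: cG].
move=> [dF DF] [dG DG]; split=> [x Ox|v].
  by apply: differentiableD; [exact: dF|exact: dG].
apply: Ck_ext (IH _ _ (DF v) (DG v)) => // x; rewrite inE => Ox.
by rewrite -deriveD //; apply: diff_derivable; [exact: dF|exact: dG].
Qed.

Lemma Ck_sum U W (O : set U) k n (F : 'I_n -> U -> W) :
  open O -> (forall i, Ck k O (F i)) -> Ck k O (fun x => \sum_i F i x).
Proof.
move=> Oo; elim: n F => [|n IH] F FO.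
  rewrite (_ : (fun x => _) = (fun=> 0)); first exact: Ck_cst.
  by rewrite funeqE => x; rewrite big_ord0.
rewrite (_ : (fun x => _) = fun x => F ord0 x + \sum_i F (lift ord0 i) x).
  by apply: CkD => //; exact: IH.
by rewrite funeqE => x; rewrite big_ord_recl.
Qed.

(** The product rule is stated for the products F_j G of a coordinate of a vector
    valued map with a map: its derivative is a sum of two products of the same
    form, so inductions on the order of differentiability need no scalar valued
    functions. *)
Lemma differentiable_scale_coord U W n (F : U -> 'rV[R]_n) (G : U -> W) (x : U) j :
  differentiable F x -> differentiable G x ->
  differentiable (fun y => F y 0 j *: G y) x /\
  forall v, 'D_v (fun y => F y 0 j *: G y) x =
    ('D_v F x) 0 j *: G x + F x 0 j *: 'D_v G x.
Proof.
move=> dF dG.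
have @co : {linear 'rV[R]_n -> R^o}.
  by exists (fun N : 'rV[R]_n => N 0 j); do 2![eexists]; do ?[constructor];
     rewrite ?mxE// => ? *; rewrite ?mxE//; move=> ?; rewrite !mxE.
have cco : continuous co by exact: coord_continuous.
have sbil : bilinear_for (GRing.Scale.Law.clone _ _ *:%R _)
    (GRing.Scale.Law.clone _ _ *:%R _) (fun (a : R^o) (w : W) => a *: w).
  split=> [w a b c|a b u w]; first by rewrite /= scalerDl -scalerA.
  by rewrite /= scalerDr !scalerA (mulrC a).
pose sb : {bilinear R^o -> W -> W} :=
  HB.pack (fun (a : R^o) (w : W) => a *: w)
    (@bilinear_isBilinear.Build R R^o W W *:%R *:%R _ sbil).
have sc : continuous (fun p => sb p.1 p.2) by exact: scale_continuous.
pose cF := co \o F.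
have dcF : differentiable cF x.
  by apply: differentiable_comp => //; exact: linear_differentiable.
have dp : differentiable (fun y => (cF y, G y)) x by exact: differentiable_pair.
have ds := @differentiable_bilin _ _ _ _ sb (cF x, G x) sc.
pose s2 := fun p : R^o * W => sb p.1 p.2.
have dsp : differentiable (s2 \o (fun y => (cF y, G y))) x.
  exact: differentiable_comp.
split=> // v.
rewrite deriveE // (_ : (fun y => _) = s2 \o (fun y => (cF y, G y))) //.
rewrite diff_comp //= diff_pair //= /s2 diff_bilin //= addrC.
have dco : 'd cF x v = 'd F x v 0 j.
  rewrite diff_comp //; last exact: linear_differentiable.
  by rewrite /comp (diff_lin _ cco).
by rewrite dco !deriveE.
Qed.

Lemma Ck_scale_coord U W (O : set U) k n (F : U -> 'rV[R]_n) (G : U -> W) j :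
  open O -> Ck k O F -> Ck k O G -> Ck k O (fun x => F x 0 j *: G x).
Proof.
move=> Oo; elim: k F G => [|k IH] F G.
  move=> cF cG x Ox.
  have cFj : {for x, continuous (fun y => F y 0 j)}.
    apply: (@continuous_comp _ _ _ F (fun M : 'rV_n => M 0 j)); first exact: cF.
    exact: coord_continuous.
  by apply: cvgZ; [exact: cFj|exact: cG].
move=> CF CG; have [dF DF] := CF; have [dG DG] := CG; split=> [x Ox|v].
  by have [] := differentiable_scale_coord j (dF x Ox) (dG x Ox).
have := CkD Oo (IH _ _ (DF v) (CkW CG)) (IH _ _ (CkW CF) (DG v)).
apply: Ck_ext => // x; rewrite inE => Ox.
by have [_ ->] := differentiable_scale_coord j (dF x Ox) (dG x Ox).
Qed.

Lemma Ck_id U (O : set U) k : Ck k O (@id U).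
Proof.
case: k => [|k] /=; first by move=> x _; exact: cvg_id.
split=> // v; rewrite (_ : 'D_v _ = (fun=> v)); first exact: Ck_cst.
by rewrite funeqE => x; rewrite derive_id.
Qed.

(** The chain rule writes the derivative of G o F along v as the sum over j of
    (D_v F)_j (D_{e_j} G o F); the second factor is covered by the induction
    hypothesis, which is why G is general in it while F is fixed. *)
Lemma Ck_comp U W n (O : set U) (O' : set 'rV[R]_n) k
    (F : U -> 'rV[R]_n) (G : 'rV[R]_n -> W) :
  open O -> (forall x, O x -> O' (F x)) ->
  Ck k O F -> Ck k O' G -> Ck k O (fun x => G (F x)).
Proof.
move=> Oo FO; elim: k W G => [|k IH] W G.
  by move=> cF cG x Ox; apply: continuous_comp; [exact: cF|exact: cG (FO _ Ox)].
move=> CF [dG DG]; have [dF DF] := CF; split=> [x Ox|v].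
  by apply: differentiable_comp; [exact: dF|exact: dG (FO _ Ox)].
have CkD' : Ck k O (fun x => \sum_j ('D_v F x) 0 j *: 'D_(delta_mx 0 j) G (F x)).
  apply: Ck_sum => // j; apply: Ck_scale_coord => //; first exact: DF.
  exact: (IH _ (fun y => 'D_(delta_mx 0 j) G y) (CkW CF) (DG _)).
apply: Ck_ext CkD' => // x; rewrite inE => Ox.
have dFx := dF x Ox; have dGx := dG _ (FO _ Ox).
rewrite [RHS]deriveE; last exact: differentiable_comp.
rewrite diff_comp //= -(deriveE v dFx) [X in 'd G _ X]row_sum_delta linear_sum /=.
by apply: eq_bigr => j _; rewrite linearZ /= -deriveE.
Qed.

Lemma Cinfty_comp U W n (O : set U) (O' : set 'rV[R]_n)
    (F : U -> 'rV[R]_n) (G : 'rV[R]_n -> W) :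
  open O -> (forall x, O x -> O' (F x)) ->
  Cinfty O F -> Cinfty O' G -> Cinfty O (fun x => G (F x)).
Proof. by move=> Oo FO CF CG k; apply: Ck_comp (CF k) (CG k). Qed.

Lemma Cinfty_linear m n (O : set 'rV[R]_m) (L : {linear 'rV[R]_m -> 'rV[R]_n}) :
  open O -> Cinfty O L.
Proof.
move=> Oo k.
rewrite (_ : L = (fun x => \sum_j x 0 j *: L (delta_mx 0 j)) :> (_ -> _)).
  by apply: Ck_sum => // j; apply: Ck_scale_coord => //; [exact: Ck_id|exact: Ck_cst].
rewrite funeqE => x; rewrite [in LHS](row_sum_delta x) linear_sum /=.
by apply: eq_bigr => j _; rewrite linearZ.
Qed.

Lemma Cinfty_row_mx U n1 n2 (O : set U) (F : U -> 'rV[R]_n1) (G : U -> 'rV[R]_n2) :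
  open O -> Cinfty O F -> Cinfty O G -> Cinfty O (fun x => row_mx (F x) (G x)).
Proof.
move=> Oo CF CG.
pose A : 'M[R]_(n1, n1 + n2) := row_mx 1%:M 0.
pose B : 'M[R]_(n2, n1 + n2) := row_mx 0 1%:M.
rewrite (_ : (fun x => _) = fun x => mulmxr A (F x) + mulmxr B (G x)).
  move=> k; apply: CkD => //.
    exact: (Ck_comp (O' := setT) (G := mulmxr A) Oo _ (CF k) (Cinfty_linear _ openT k)).
  exact: (Ck_comp (O' := setT) (G := mulmxr B) Oo _ (CG k) (Cinfty_linear _ openT k)).
rewrite funeqE => x; rewrite /A /B /= !mul_mx_row add_row_mx.
by rewrite !mulmx1 !mulmx0 addr0 add0r.
Qed.

Lemma Cinfty_continuous U W (O : set U) (F : U -> W) x :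
  Cinfty O F -> O x -> {for x, continuous F}.
Proof. by move=> /(_ 0%N) cF /cF. Qed.
End Ck_calculus.

(** * Smooth maps between spaces with an atlas *)

Lemma open_setI_preimage (S T : topologicalType) (O : set S) (Q' : set T) (F : S -> T) :
  open O -> (forall x, O x -> {for x, continuous F}) -> open Q' ->
  open (O `&` F @^-1` Q').
Proof.
move=> Oo cF Q'o; rewrite openE => x [Ox Q'Fx].
apply: filterI; first exact: open_nbhs_nbhs.
exact: cF (open_nbhs_nbhs _).
Qed.

Section Smooth_maps.
Variable R : realType.
Implicit Types M N K : smoothSpace R.

(** What composing and pairing smooth maps requires of the spaces involved; in this
    form it holds at once for manifolds, their products and vector spaces. *)
Record smooth_atlas M : Prop := {
  atlas_inj : forall c : chart R M, charts c ->
    forall a b, cdom c a -> cdom c b -> cmap c a = cmap c b -> a = b;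
  atlas_cover : forall x : M, exists (c : chart R M) a,
    [/\ charts c, cdom c a & cmap c a = x];
  atlas_compat : forall (c d : chart R M) a b, charts c -> charts d ->
    cdom c a -> cdom d b -> cmap c a = cmap d b ->
    exists F, local_rep setT id c d a F }.

Lemma manifold_atlas M : is_manifold M -> smooth_atlas M.
Proof. by case. Qed.

Lemma local_rep_sub M N (A B : set M) (f : M -> N) c d a F :
  B `<=` A -> local_rep A f c d a F -> local_rep B f c d a F.
Proof.
move=> BA [ O [Oo Oa CF FO]]; exists O; split=> // b Ob cb /BA Ab; exact: FO.
Qed.

Lemma local_rep_comp M N K (A : set M) (B : set N) (f : M -> N) (g : N -> K)
    c d e a F G :
  (forall x, A x -> B (f x)) ->
  local_rep A f c d a F -> local_rep B g d e (F a) G ->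
  local_rep A (g \o f) c e a (G \o F).
Proof.
move=> AB [ O [Oo Oa CF FO]] [ Q' [Q'o Q'a CG GO]].
have OO : open (O `&` F @^-1` Q').
  by apply: open_setI_preimage => // x; exact: Cinfty_continuous.
exists (O `&` F @^-1` Q'); split=> //.
  apply: (@Cinfty_comp _ _ _ _ _ Q') => //; first by move=> x [].
  by move=> k; apply: Ck_sub (CF k) => x [].
move=> b [Ob Q'b] cb Ab; have [dFb eFb] := FO b Ob cb Ab.
by rewrite /= -eFb; apply: GO => //; rewrite eFb; exact: AB.
Qed.

Lemma local_rep_val M N (A : set M) (f : M -> N) c d a F :
  local_rep A f c d a F -> cdom c a -> A (cmap c a) ->
  cdom d (F a) /\ cmap d (F a) = f (cmap c a).
Proof. by move=> [ O [_ Oa _ +]] ca Aa; apply. Qed.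

(** Injectivity of charts makes the change of coordinates send a exactly to b, so
    that a local representative at b can be composed with it. *)
Lemma transition M (A : set M) (c d : chart R M) a b : smooth_atlas M ->
  charts c -> charts d -> cdom c a -> cdom d b -> cmap c a = cmap d b ->
  exists2 T, T a = b & local_rep A id c d a T.
Proof.
move=> [aI _ compat] hc hd ca db ab.
have [T hT] := compat c d a b hc hd ca db ab; exists T.
  by have [dT eT] := local_rep_val hT ca I; apply: (aI d) => //; rewrite eT.
exact: local_rep_sub hT.
Qed.

(** The definition of smoothness provides some charts; conjugating with changes of
    coordinates gives a representative in any prescribed charts. *)
Lemma smooth_on_rep M N (A : set M) (f : M -> N) c d a b :
  smooth_atlas M -> smooth_atlas N -> smooth_on A f ->
  charts c -> charts d -> cdom c a -> cdom d b ->
  A (cmap c a) -> cmap d b = f (cmap c a) ->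
  exists F, local_rep A f c d a F.
Proof.
move=> aM aN sf hc hd ca db Aa efa.
have [c' [d' [a' [F [hc' hd' ca' ea' hF]]]]] := sf _ Aa.
have [T Ta hT] := transition A aM hc hc' ca ca' (esym ea').
have := local_rep_val hF ca'; rewrite ea' => /(_ Aa) [dFa' eFa'].
have [S Sb hS] := transition setT aN hd' hd dFa' db (etrans eFa' (esym efa)).
exists (S \o (F \o T)); apply: (local_rep_comp (B := setT) (f := f) (g := id)) => //.
  by apply: (local_rep_comp (B := A) (f := id) (g := f)) hT _ => //; rewrite Ta.
by rewrite /= Ta.
Qed.

Lemma smooth_on_comp M N K (A : set M) (B : set N) (f : M -> N) (g : N -> K) :
  smooth_atlas N -> (forall x, A x -> B (f x)) ->
  smooth_on A f -> smooth_on B g -> smooth_on A (fun x => g (f x)).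
Proof.
move=> aN AB sf sg x Ax.
have [c [d [a [F [hc hd ca ea hF]]]]] := sf _ Ax.
have [d' [e [b [G [hd' he db eb hG]]]]] := sg _ (AB _ Ax).
have := local_rep_val hF ca; rewrite ea => /(_ Ax) [dFa eFa].
have [T Tb hT] := transition B aN hd hd' dFa db (etrans eFa (esym eb)).
exists c, e, a, (G \o (T \o F)); split=> //.
apply: (local_rep_comp (B := B) (f := f)) => //; last by rewrite /= Tb.
exact: (local_rep_comp (B := B) (f := f) (g := id)).
Qed.

Lemma smooth_on_pair M N K (A : set M) (f : M -> N) (g : M -> K) :
  smooth_atlas M -> smooth_on A f -> smooth_on A g ->
  @smooth_on R M (prodSpace N K) A (fun x => (f x, g x)).
Proof.
move=> aM sf sg x Ax.
have [c [d [a [F [hc hd ca ea [ O [Oo Oa CF FO]]]]]]] := sf _ Ax.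
have [c' [e [a' [G [hc' he ca' ea' hG]]]]] := sg _ Ax.
have [T Ta hT] := transition A aM hc hc' ca ca' (etrans ea (esym ea')).
have [ Q' [Q'o Q'a CG GO]] : local_rep A g c e a (G \o T).
  by apply: (local_rep_comp (B := A) (f := id) (g := g)) hT _ => //; rewrite Ta.
exists c, (prodChart d e), a, (fun b => row_mx (F b) (G (T b))); split=> //.
  by exists d, e.
have OO : open (O `&` Q') by exact: openI.
exists (O `&` Q'); split=> //.
  apply: Cinfty_row_mx => // k.
    by apply: Ck_sub (CF k) => ? [].
  by apply: Ck_sub (CG k) => ? [].
move=> b [Ob Q'b] cb Ab /=; rewrite row_mxKl row_mxKr.
have [? ->] := FO b Ob cb Ab; have [? /= ->] := GO b Q'b cb Ab.
by split.
Qed.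

Lemma smooth_on_cst M N (A : set M) (y : N) :
  smooth_atlas M -> smooth_atlas N -> @smooth_on R M N A (fun=> y).
Proof.
move=> aM aN x _; have [c [a [hc ca ea]]] := atlas_cover aM x.
have [d [b [hd db eb]]] := atlas_cover aN y.
exists c, d, a, (fun=> b); split=> //.
by exists setT; split=> //; [exact: openT|move=> k; exact: Ck_cst].
Qed.

Lemma smooth_on_id M (A : set M) : smooth_atlas M -> @smooth_on R M M A id.
Proof.
move=> aM x _; have [c [a [hc ca ea]]] := atlas_cover aM x.
exists c, c, a, id; split=> //.
by exists setT; split=> //; [exact: openT|move=> k; exact: Ck_id].
Qed.

Lemma smooth_on_fst M N (A : set (M * N)) : smooth_atlas M -> smooth_atlas N ->
  @smooth_on R (prodSpace M N) M A fst.
Proof.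
move=> aM aN [x y] _; have [c [a [hc ca ea]]] := atlas_cover aM x.
have [d [b [hd db eb]]] := atlas_cover aN y.
exists (prodChart c d), c, (row_mx a b), lsubmx; split=> //.
- by exists c, d.
- by rewrite /= row_mxKl row_mxKr.
- by rewrite /= row_mxKl row_mxKr ea eb.
exists setT; split=> //; [exact: openT|exact/Cinfty_linear/openT|].
by move=> w _ [].
Qed.

Lemma smooth_on_snd M N (A : set (M * N)) : smooth_atlas M -> smooth_atlas N ->
  @smooth_on R (prodSpace M N) N A snd.
Proof.
move=> aM aN [x y] _; have [c [a [hc ca ea]]] := atlas_cover aM x.
have [d [b [hd db eb]]] := atlas_cover aN y.
exists (prodChart c d), d, (row_mx a b), rsubmx; split=> //.
- by exists c, d.
- by rewrite /= row_mxKl row_mxKr.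
- by rewrite /= row_mxKl row_mxKr ea eb.
exists setT; split=> //; [exact: openT|exact/Cinfty_linear/openT|].
by move=> w _ [].
Qed.

Lemma prod_atlas M N : smooth_atlas M -> smooth_atlas N ->
  smooth_atlas (prodSpace M N).
Proof.
move=> aM aN; split.
- move=> _ [c [d [hc hd ->]]] u v /= [cu du] [cv dv] [ec ed].
  rewrite -(hsubmxK u) -(hsubmxK v).
  by congr row_mx; [apply: (atlas_inj aM hc)|apply: (atlas_inj aN hd)].
- move=> [x y]; have [c [a [hc ca ea]]] := atlas_cover aM x.
  have [d [b [hd db eb]]] := atlas_cover aN y.
  exists (prodChart c d), (row_mx a b); split; first by exists c, d.
    by rewrite /= row_mxKl row_mxKr.
  by rewrite /= row_mxKl row_mxKr ea eb.
- move=> e e' u v he he'; move: he u => [c [d [hc hd ->]]] u.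
  move: he' v => [c' [d' [hc' hd' ->]]] v /=.
  move=> [cu du] [cv dv] [ec ed].
  have [F [ O [Oo Oa CF FO]]] := atlas_compat aM hc hc' cu cv ec.
  have [G [ Q' [Q'o Q'a CG GO]]] := atlas_compat aN hd hd' du dv ed.
  exists (fun w => row_mx (F (lsubmx w)) (G (rsubmx w))).
  pose Q := (lsubmx @^-1` O `&` rsubmx @^-1` Q' : set 'rV[R]_(cdim c + cdim d)).
  have Qo : open Q.
    by apply: openI; apply: open_comp => // w _;
      [exact: continuous_lsubmx|exact: continuous_rsubmx].
  exists Q; split=> //.
    apply: Cinfty_row_mx => //.
      apply: (@Cinfty_comp _ _ _ _ _ O) => //; first by move=> w [].
      exact: Cinfty_linear.
    apply: (@Cinfty_comp _ _ _ _ _ Q') => //; first by move=> w [].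
    exact: Cinfty_linear.
  move=> w [Ow Q'w] [cw dw] _ /=; rewrite row_mxKl row_mxKr.
  have [? ->] := FO _ Ow cw I; have [? ->] := GO _ Q'w dw I.
  by split.
Qed.

Lemma vect_atlas (V : vectType R) : smooth_atlas (vectSpace V).
Proof.
split.
- by move=> _ -> a b _ _ /= /(can_inj r2vK).
- move=> v; exists (@Chart R V (dim V) setT (@r2v R V)), (v2r v).
  by split=> //=; rewrite v2rK.
- move=> c d a b hc hd; move: hc a => /= -> a; move: hd b => /= -> b _ _ _.
  exists id, setT; split=> //; first exact: openT.
  by move=> k; exact: Ck_id.
Qed.

Lemma smooth_linear (V W : vectType R) (f : {linear V -> W}) :
  @smooth R (vectSpace V) (vectSpace W) f.
Proof.
move=> v _; exists (@Chart R V (dim V) setT (@r2v R V)).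
exists (@Chart R W (dim W) setT (@r2v R W)).
pose F : {linear 'rV[R]_(dim V) -> 'rV[R]_(dim W)} := v2r \o (f \o r2v).
exists (v2r v), F; split=> //=; first exact: v2rK.
exists setT; split=> //; [exact: openT|exact: (@Cinfty_linear _ _ _ setT F openT)|].
by move=> w _ _ _ /=; rewrite v2rK.
Qed.

End Smooth_maps.

(** * Groups, principal bundles and associated bundles *)

Section Group_laws.
Variables (R : realType) (G : lieGroup R).
Local Notation mul := (@lgr_mul R G).
Local Notation inv := (@lgr_inv R G).
Local Notation one := (@lgr_one R G).

Lemma lgr_mulI g : injective (mul g).
Proof.
by move=> a b /(congr1 (mul (inv g))); rewrite !lgr_mulA lgr_mulV !lgr_mul1.
Qed.

Lemma lgr_mulr1 g : mul g one = g.
Proof. by apply: (@lgr_mulI (inv g)); rewrite lgr_mulA lgr_mulV lgr_mul1. Qed.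

Lemma lgr_mulrV g : mul g (inv g) = one.
Proof. by apply: (@lgr_mulI (inv g)); rewrite lgr_mulA lgr_mulV lgr_mul1 lgr_mulr1. Qed.

Lemma lgr_invE g h : mul g h = one -> g = inv h.
Proof.
move=> gh; have := lgr_mulr1 g.
by rewrite -(lgr_mulrV h) lgr_mulA gh lgr_mul1.
Qed.

Lemma lgr_invK : involutive inv.
Proof. by move=> g; exact/esym/lgr_invE/lgr_mulrV. Qed.

Lemma lgr_inv1 : inv one = one.
Proof. exact/esym/lgr_invE/lgr_mul1. Qed.

Lemma lgr_invM g h : inv (mul g h) = mul (inv h) (inv g).
Proof.
apply/esym/lgr_invE.
by rewrite -lgr_mulA (lgr_mulA (inv g)) lgr_mulV lgr_mul1 lgr_mulV.
Qed.

End Group_laws.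

Section Principal.
Variables (R : realType) (G : lieGroup R) (P M : smoothSpace R).
Variables (pr : P -> M) (act : P -> G -> P).
Hypothesis hP : principal_bundle pr act.

(** In a local trivialization the action is the right translation on the group. *)
Lemma principal_free p g : act p g = p -> g = lgr_one G.
Proof.
have [U [Phi [Psi [[_ Ux] _ PhiK PsiK equ]]]] := pb_triv hP (pr p).
have [ep1 ep2] := PsiK p Ux; move: ep1 ep2; case: (Psi p) => y k /= -> <- eg.
have [_ actE] := equ (pr p) k g Ux; move: eg; rewrite -actE.
move=> /(congr1 (fun q => (Psi q).2)); rewrite !PhiK //= => kg.
by apply: (@lgr_mulI _ _ k); rewrite lgr_mulr1.
Qed.

Lemma principal_fibre p q : pr p = pr q -> exists g, q = act p g.
Proof.
have [U [Phi [Psi [[_ Ux] _ PhiK PsiK equ]]]] := pb_triv hP (pr p) => pq.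
have [ep1 ep2] := PsiK p Ux; move: ep1 ep2; case: (Psi p) => y k /= -> <-.
have [|eq1 eq2] := PsiK q; first by rewrite -pq.
move: eq1 eq2; case: (Psi q) => z l /= -> <-.
exists (lgr_mul (lgr_inv k) l).
have [_ <-] := equ (pr p) k (lgr_mul (lgr_inv k) l) Ux.
by rewrite lgr_mulA lgr_mulrV lgr_mul1 -pq.
Qed.

(** The section is the image of the unit element in a local trivialization, and
    delta p is the group coordinate of p, i.e. its displacement from the
    section. *)
Lemma principal_section (aM : smooth_atlas M) x :
  exists (U : set M) (sigma : M -> P) (delta : P -> G),
    [/\ mopen U /\ U x, smooth_on U sigma, forall y, U y -> pr (sigma y) = y,
        smooth_on [set p | U (pr p)] delta &
        forall p, U (pr p) -> p = act (sigma (pr p)) (delta p)].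
Proof.
have [U [Phi [Psi [Uo [sPhi sPsi] PhiK PsiK equ]]]] := pb_triv hP x.
have aG := manifold_atlas (lgr_manifold G).
exists U, (fun y => Phi (y, lgr_one G)), (fun p => (Psi p).2); split=> //.
- apply: (smooth_on_comp (prod_atlas aM aG) _ _ sPhi) => //.
  apply: smooth_on_pair => //; first exact: smooth_on_id.
  exact: smooth_on_cst.
- by move=> y Uy; have [] := equ y (lgr_one G) (lgr_one G) Uy.
- apply: (smooth_on_comp (B := setT) (prod_atlas aM aG) _ sPsi) => //.
  exact: smooth_on_snd.
- move=> p Up; have [_ <-] := equ (pr p) (lgr_one G) (Psi p).2 Up.
  have [ep1 ep2] := PsiK p Up.
  by rewrite lgr_mul1 -ep1 -surjective_pairing.
Qed.

Variables (V : vectType R) (rho : G -> V -> V).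
Hypothesis hrho : linear_rep rho.
Local Notation cls := (@Defs.cls R G P act V rho).

Lemma cls_act p g v : cls (act p g) v = cls p (rho g v).
Proof.
apply: eq_exist; apply/seteqP; split=> _ [h ->] /=.
  exists (lgr_mul g h); rewrite (pb_actM hP) lgr_invM.
  by rewrite -(rep_mul hrho) -lgr_mulA lgr_mulV lgr_mulr1.
exists (lgr_mul (lgr_inv g) h).
rewrite -(pb_actM hP) lgr_mulA lgr_mulrV lgr_mul1 lgr_invM lgr_invK.
by rewrite (rep_mul hrho).
Qed.

Lemma cls_inj p q v w : cls p v = cls q w ->
  exists g, q = act p g /\ v = rho g w.
Proof.
move=> /(congr1 (@proj1_sig _ _)) /= eqO.
have : assocOrbit act rho (q, w) (q, w).
  by exists (lgr_one G); rewrite (pb_act1 hP) lgr_inv1 (rep_one hrho).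
rewrite -eqO => -[g [-> ->]]; exists g; split=> //.
by rewrite -(rep_mul hrho) lgr_mulrV (rep_one hrho).
Qed.

(** Only the unit fixes p, so a vector of the fibre has one coordinate in V once
    its point of P is chosen. *)
Lemma cls_fibre_inj p v w : cls p v = cls p w -> v = w.
Proof.
move=> /cls_inj[g [/esym/principal_free -> ->]].
by rewrite (rep_one hrho).
Qed.

Lemma cls_rep d : cls (rep d).1 (rep d).2 = d.
Proof.
case: d => O h; apply: eq_exist; rewrite /rep /=.
by case: cid => u /= ->; case: u.
Qed.

Lemma rep_cls p v : exists g, p = act (rep (cls p v)).1 g /\ (rep (cls p v)).2 = rho g v.
Proof. exact/cls_inj/cls_rep. Qed.

(** Two points of the same fibre have representatives with a common first
    component, on which sums are computed. *)
Lemma cls_fibre d p : pr (rep d).1 = pr p -> exists v, d = cls p v.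
Proof.
move=> /esym/principal_fibre[g eg]; exists (rho g (rep d).2).
by rewrite -cls_act -eg cls_rep.
Qed.

Lemma pr_cls p v : pr (rep (cls p v)).1 = pr p.
Proof. by have [g [e _]] := rep_cls p v; rewrite [in RHS]e (pb_pr_act hP). Qed.

Lemma choice_ofE (T : Type) (x0 x : T) (Q : T -> Prop) :
  Q x -> (forall y, Q y -> y = x) -> choice_of x0 Q = x.
Proof.
rewrite /choice_of => Qx uQ; case: pselect => [h|[]]; last by exists x.
by apply: uQ; case: cid.
Qed.

Lemma assocAdd_cls p v w :
  assocAdd (cls p v) (cls p w) = cls p (v + w).
Proof.
apply: choice_ofE; first by exists p, v, w.
move=> s [q [v' [w' [ev ew ->]]]].
have [g [eq ->]] := cls_inj ev; move: ew; rewrite eq cls_act => /cls_fibre_inj ->.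
rewrite cls_act; congr Defs.cls.
by rewrite -[v']scale1r (rep_linear hrho) !scale1r.
Qed.

Lemma assocScale_cls a p v : assocScale a (cls p v) = cls p (a *: v).
Proof.
rewrite /assocScale; have [g [eq ->]] := rep_cls p v.
have rho0 : rho g 0 = 0.
  have := rep_linear hrho g 1 0 0; rewrite !scale1r addr0 => e0.
  by apply: (@addrI _ (rho g 0)); rewrite addr0 -e0.
rewrite [in RHS]eq cls_act; congr Defs.cls.
by rewrite -[a *: v]addr0 (rep_linear hrho) rho0 addr0.
Qed.

End Principal.

(** * The cleavage of the associated VB-groupoid *)

Section Cleavage.
Variables (R : realType) (G : lie2Group R) (X : lieGroupoid R).
Variables (E : principal2Bundle G X) (C : Ar X -> Ob E -> Ar E).
Hypothesis hC : quasi_connection C.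
Variables (V : twoVectorSpace R) (rho : left_action G V).

Let hP0 := p2b_principal0 E.
Let hP1 := p2b_principal1 E.
Let hr0 := rho_rep0 rho.
Let hr1 := rho_rep1 rho.
Let catV := vcat_ax V.
Local Notation D := (assocVB E rho).
Local Notation cls0 := (@cls R (G0 G) (Ob E) (@act0 R G X E) (V0 V) (@rho0 R G V rho)).
Local Notation cls1 := (@cls R (G1 G) (Ar E) (@act1 R G X E) (V1 V) (@rho1 R G V rho)).

Lemma src_act1 f g : src (act1 f g : Ar E) = act0 (src f) (@src R G g).
Proof. by have := fun_src (p2b_act_functor E) (f, g). Qed.

Lemma tgt_act1 f g : tgt (act1 f g : Ar E) = act0 (tgt f) (@tgt R G g).
Proof. by have := fun_tgt (p2b_act_functor E) (f, g). Qed.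

Lemma id_act0 p g : idar (act0 p g : Ob E) = act1 (idar p) (@idar R G g).
Proof. by have := fun_id (p2b_act_functor E) (p, g). Qed.

Lemma vsrc_rho1 g z : vsrc V (rho1 rho g z) = rho0 rho (@src R G g) (vsrc V z).
Proof. by have := fun_src (rho_functor rho) (g, z). Qed.

Lemma vtgt_rho1 g z : vtgt V (rho1 rho g z) = rho0 rho (@tgt R G g) (vtgt V z).
Proof. by have := fun_tgt (rho_functor rho) (g, z). Qed.

Lemma vid_rho0 g v : vid V (rho0 rho g v) = rho1 rho (@idar R G g) (vid V v).
Proof. by have := fun_id (rho_functor rho) (g, v). Qed.

Lemma vsrc_vid v : vsrc V (vid V v) = v. Proof. exact: cat_src_id catV v. Qed.
Lemma vtgt_vid v : vtgt V (vid V v) = v. Proof. exact: cat_tgt_id catV v. Qed.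

Lemma src_cls f z : src (cls1 f z : Ar D) = cls0 (src f) (vsrc V z).
Proof.
rewrite /=; have [g [e ->]] := rep_cls hP1 hr1 f z.
by rewrite [in RHS]e vsrc_rho1 src_act1 (cls_act hP0 hr0).
Qed.

Lemma tgt_cls f z : tgt (cls1 f z : Ar D) = cls0 (tgt f) (vtgt V z).
Proof.
rewrite /=; have [g [e ->]] := rep_cls hP1 hr1 f z.
by rewrite [in RHS]e vtgt_rho1 tgt_act1 (cls_act hP0 hr0).
Qed.

Lemma idar_cls p v : idar (cls0 p v : Ob D) = cls1 (idar p) (vid V v).
Proof.
rewrite /=; have [g [e ->]] := rep_cls hP0 hr0 p v.
by rewrite [in RHS]e vid_rho0 id_act0 (cls_act hP1 hr1).
Qed.

Lemma vb_pr0_cls p v : vb_pr0 (cls0 p v : Ob D) = pr0 p.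
Proof. exact: (pr_cls hP0 hr0 p v). Qed.

Lemma vb_pr1_cls f z : vb_pr1 (cls1 f z : Ar D) = pr1 f.
Proof. exact: (pr_cls hP1 hr1 f z). Qed.

Lemma add0_cls p v w : add0 (cls0 p v : Ob D) (cls0 p w) = cls0 p (v + w).
Proof. exact: (assocAdd_cls hP0 hr0). Qed.

Lemma add1_cls f z y : add1 (cls1 f z : Ar D) (cls1 f y) = cls1 f (z + y).
Proof. exact: (assocAdd_cls hP1 hr1). Qed.

Lemma scale0_cls a p v : scale0 a (cls0 p v : Ob D) = cls0 p (a *: v).
Proof. exact: (assocScale_cls hP0 hr0). Qed.

Lemma scale1_cls a f z : scale1 a (cls1 f z : Ar D) = cls1 f (a *: z).
Proof. exact: (assocScale_cls hP1 hr1). Qed.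

(** Other composable representatives are (f_i g_i, g_i^-1 z_i).  The action on
    objects is free and f_1 g_1, f_2 g_2 are composable, so g_1 and g_2 are
    composable too, and their composite relates the two composites. *)
Lemma comp_cls (f2 f1 : Ar E) (z2 z1 : V1 V) :
  tgt f1 = src f2 -> vtgt V z1 = vsrc V z2 ->
  Defs.comp (cls1 f2 z2 : Ar D) (cls1 f1 z1) = cls1 (Defs.comp f2 f1) (vcomp z2 z1).
Proof.
move=> f12 z12; apply: choice_ofE; first by exists f2, z2, f1, z1.
move=> d [f2' [y2 [f1' [y1 [[/(cls_inj hP1 hr1)[g2 [ef2 ->]] e1] f12' y12 ->]]]]].
have [g1 [ef1 ->]] := cls_inj hP1 hr1 e1.
have g12 : @tgt R G g1 = @src R G g2.
  move: f12'; rewrite ef1 ef2 tgt_act1 src_act1 f12 => e.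
  have : act0 (src f2) (lgr_mul (@tgt R G g1 : G0 G)
      (lgr_inv (@src R G g2 : G0 G))) = src f2.
    by rewrite (pb_actM hP0) e -(pb_actM hP0) lgr_mulrV (pb_act1 hP0).
  by move=> /(principal_free hP0)/lgr_invE; rewrite lgr_invK.
have -> : vcomp (rho1 rho g2 y2) (rho1 rho g1 y1) =
    rho1 rho (@Defs.comp R G g2 g1) (vcomp y2 y1).
  have := fun_comp (rho_functor rho) (g := (g2, y2)) (f := (g1, y1)).
  by move=> /= -> //; congr pair.
rewrite -(cls_act hP1 hr1) ef1 ef2.
have := fun_comp (p2b_act_functor E) (g := (f2, g2)) (f := (f1, g1)).
by move=> /= <- //; congr pair.
Qed.

Definition assocC (gamma : Ar X) (d : Ob D) : Ar D :=
  cls1 (C gamma (rep d).1) (vid V (rep d).2).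

(** The class does not depend on the representative, by equivariance of C. *)
Lemma assocC_cls gamma p v : src gamma = pr0 p ->
  assocC gamma (cls0 p v) = cls1 (C gamma p) (vid V v).
Proof.
rewrite /assocC; have [g [e ->]] := rep_cls hP0 hr0 p v.
rewrite [in pr0 _]e [in C gamma p]e (pb_pr_act hP0) => srcg.
by rewrite vid_rho0 (qc_act hC) // (cls_act hP1 hr1).
Qed.

Lemma Ob_clsP (d : Ob D) : exists p v, d = cls0 p v.
Proof. by exists (rep d).1, (rep d).2; rewrite cls_rep. Qed.

Lemma assocC_unital : unital_connection C -> unital_cleavage assocC.
Proof.
move=> uC d; have [p [v ->]] := Ob_clsP d.
by rewrite vb_pr0_cls assocC_cls ?uC ?idar_cls// (cat_src_id (lgd_cat (lgd_ax X))).
Qed.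

Lemma assocC_flat : categorical_connection C -> flat_cleavage assocC.
Proof.
move=> [_ cC] gamma1 gamma2 d1 _ + g12 ->; have [p [v ->]] := Ob_clsP d1.
rewrite vb_pr0_cls => sg1.
have sC : src gamma2 = pr0 (tgt (C gamma1 p)).
  by rewrite -(fun_tgt (p2b_pr_functor E)) (qc_pr hC).
rewrite (assocC_cls v sg1) tgt_cls vtgt_vid (assocC_cls v sC) assocC_cls; last first.
  by rewrite (cat_src_comp (lgd_cat (lgd_ax X))).
rewrite comp_cls ?vtgt_vid ?vsrc_vid ?(qc_src hC) // -cC //.
congr cls1; apply: esym.
by have := cat_comp_id catV (vid V v); rewrite /= vsrc_vid.
Qed.

(** In the trivializations given by local sections sigma0 and sigma1, the fibre
    component of the cleavage is the map kappa below: the displacement of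
    C (gamma', sigma0 x) from sigma1 gamma', applied to 1_w. *)
Lemma assocC_smooth : @smooth_on R (prodSpace (Ar X) (Ob D)) (Ar D)
  [set u | src u.1 = vb_pr0 u.2] (fun u => assocC u.1 u.2).
Proof.
have aX0 := manifold_atlas (lgd_ob (lgd_ax X)).
have aX1 := manifold_atlas (lgd_ar (lgd_ax X)).
have aE0 := manifold_atlas (lgd_ob (lgd_ax E)).
have aE1 := manifold_atlas (lgd_ar (lgd_ax E)).
have aG1 := manifold_atlas (lgd_ar (lgd_ax G)).
have aV0 := vect_atlas (V0 V).
have aV1 := vect_atlas (V1 V).
move=> [gamma d] /= srcg.
pose x := src gamma.
have [U0 [sigma0 [_ [[U0o U0x] ssigma0 psigma0 _ _]]]] := principal_section hP0 aX0 x.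
have [U1 [sigma1 [delta1 [[U1o U1g] ssigma1 psigma1 sdelta1 edelta1]]]] :=
  principal_section hP1 aX1 gamma.
have [v ->] : exists v, d = cls0 (sigma0 x) v.
  by apply: (cls_fibre hP0 hr0); rewrite psigma0 // /x srcg.
pose K := prodSpace (Ar X) (prodSpace (Ob X) (vectSpace (V0 V))).
have aK : smooth_atlas K by do 2![apply: prod_atlas => //].
pose A : set K := [set u | [/\ src u.1 = u.2.1, U0 u.2.1 & U1 u.1]].
pose kappa (u : K) : vectSpace (V1 V) :=
  rho1 rho (delta1 (C u.1 (sigma0 u.2.1))) (vid V u.2.2).
have skappa : smooth_on A kappa.
  have sx0 : @smooth_on R K (Ob X) A (fun u => u.2.1).
    apply: (@smooth_on_comp R K (prodSpace (Ob X) (vectSpace (V0 V)))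
      _ _ setT snd fst) => //.
    - exact: prod_atlas.
    - by apply: smooth_on_snd => //; exact: prod_atlas.
    - exact: smooth_on_fst.
  have sv : @smooth_on R K (vectSpace (V0 V)) A (fun u => u.2.2).
    apply: (@smooth_on_comp R K (prodSpace (Ob X) (vectSpace (V0 V)))
      _ _ setT snd snd) => //.
    - exact: prod_atlas.
    - by apply: smooth_on_snd => //; exact: prod_atlas.
    - exact: smooth_on_snd.
  have sC : @smooth_on R K (Ar E) A (fun u => C u.1 (sigma0 u.2.1)).
    apply: (@smooth_on_comp R K (prodSpace (Ar X) (Ob E)) _ _ _
      (fun u => (u.1, sigma0 u.2.1)) _ (prod_atlas aX1 aE0) _ _ (qc_smooth hC)).
    - by move=> u [srcu U0u _] /=; rewrite psigma0.
    apply: smooth_on_pair => //.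
    + by apply: smooth_on_fst => //; exact: prod_atlas.
    + by apply: (smooth_on_comp aX0 _ sx0 ssigma0) => u [].
  apply: (@smooth_on_comp R K (prodSpace (G1 G) (vectSpace (V1 V))) _ _ setT
      (fun u => (delta1 (C u.1 (sigma0 u.2.1)), vid V u.2.2)) _ _ _ _
      (rep_smooth hr1)) => //.
  - exact: prod_atlas.
  apply: smooth_on_pair => //.
  - apply: (smooth_on_comp aE1 _ sC sdelta1) => u [srcu U0u U1u] /=.
    by rewrite (qc_pr hC) // psigma0.
  - by apply: (smooth_on_comp (B := setT) aV0 _ sv) => //; exact: smooth_linear.
have [c1 [a1 [hc1 ca1 ea1]]] := atlas_cover aX1 gamma.
have [c0 [a0 [hc0 ca0 ea0]]] := atlas_cover aX0 x.
pose cV (W : vectType R) := @Chart R W (dim W) setT (@r2v R W).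
pose a := row_mx a1 (row_mx a0 (v2r v)).
have [F [ O [Oo Oa CF FO]]] : exists F, local_rep A kappa
    (prodChart c1 (prodChart c0 (cV (V0 V)))) (cV (V1 V)) a F.
  apply: (@smooth_on_rep R K (vectSpace (V1 V)) A kappa
    (prodChart c1 (prodChart c0 (cV (V0 V)))) (cV (V1 V)) a
    (v2r (kappa (gamma, (x, v)))) aK aV1 skappa).
  - by exists c1, (prodChart c0 (cV (V0 V))); split=> //; exists c0, (cV (V0 V)).
  - by [].
  - by rewrite /= !row_mxKl !row_mxKr !row_mxKl.
  - by [].
  - by rewrite /= !row_mxKl !row_mxKr !row_mxKl ea0 ea1; split.
  - by rewrite /= !row_mxKl !row_mxKr !row_mxKl v2rK ea0 ea1 v2rK.
pose O1 : set 'rV[R]_(cdim c1) := [set b | cdom c1 b /\ U1 (cmap c1 b)].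
pose e0 := assocChart (@act0 R G X E) (rho0 rho) c0 U0 sigma0.
pose e1 := assocChart (@act1 R G X E) (rho1 rho) c1 U1 sigma1.
exists (prodChart c1 e0), e1, a, (fun b => row_mx (lsubmx b) (F b)); split.
- by exists c1, e0; split=> //; exists c0, U0, sigma0.
- by exists c1, U1, sigma1.
- by rewrite /= !row_mxKl !row_mxKr !row_mxKl ea0.
- by rewrite /= !row_mxKl !row_mxKr !row_mxKl ea0 ea1 v2rK.
(* The chart e1 is only defined over U1, hence the restriction to O1. *)
exists (O `&` lsubmx @^-1` O1).
have Qo : open (O `&` lsubmx @^-1` O1).
  apply: (open_setI_preimage Oo); last exact: U1o c1 hc1.
  by move=> b _; exact: continuous_lsubmx.
split=> //.
- by split=> //; rewrite /O1 /= row_mxKl ea1.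
- apply: Cinfty_row_mx => //; first exact: Cinfty_linear.
  by move=> k; apply: Ck_sub (CF k) => b [].
move=> b [Ob [cb1 U1b]] [_ [/= cb0 U0b]].
move=> /= srcb0; have srcb : src (cmap c1 (lsubmx b)) = cmap c0 (lsubmx (rsubmx b)).
  by rewrite srcb0 (pr_cls hP0 hr0) psigma0.
rewrite /= !row_mxKl !row_mxKr; split=> //.
have Ab : A (cmap (prodChart c1 (prodChart c0 (cV (V0 V)))) b) by split.
have [_ /= ->] : _ := FO b Ob (conj cb1 (conj cb0 I)) Ab.
rewrite /kappa /= assocC_cls ?psigma0 //.
set q := C _ _; have qp : pr1 q = cmap c1 (lsubmx b) by rewrite (qc_pr hC) ?psigma0.
by rewrite -(cls_act hP1 hr1) -qp -edelta1 ?qp.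
Qed.

Lemma assocC_cleavage : linear_cleavage assocC.
Proof.
split.
- exact: assocC_smooth.
- move=> gamma d; have [p [v ->]] := Ob_clsP d.
  by rewrite vb_pr0_cls => sg; rewrite assocC_cls // vb_pr1_cls (qc_pr hC).
- move=> gamma d; have [p [v ->]] := Ob_clsP d.
  by rewrite vb_pr0_cls => sg; rewrite assocC_cls // src_cls (qc_src hC) // vsrc_vid.
- move=> gamma d1 d2; have [p [v ->]] := Ob_clsP d1.
  rewrite vb_pr0_cls => sg sg2.
  have [w ->] : exists w, d2 = cls0 p w.
    exact: (cls_fibre hP0 hr0 (etrans (esym sg2) sg)).
  by rewrite add0_cls !assocC_cls // linearD add1_cls.
- move=> gamma a d; have [p [v ->]] := Ob_clsP d.
  rewrite vb_pr0_cls => sg.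
  by rewrite scale0_cls !assocC_cls // linearZ scale1_cls.
Qed.

End Cleavage.

Theorem proposition6p5 (R : realType) (G : lie2Group R) (X : lieGroupoid R)
    (E : principal2Bundle G X) (C : Ar X -> Ob E -> Ar E)
    (hC : quasi_connection C) (V : twoVectorSpace R) (rho : left_action G V) :
  exists CV : Ar X -> Ob (assocVB E rho) -> Ar (assocVB E rho),
    [/\ linear_cleavage CV,
        forall (gamma : Ar X) (p : Ob E) (v : V0 V), src gamma = pr0 p ->
          CV gamma (cls _ _ p v) = cls _ _ (C gamma p) (vid V v),
        unital_connection C -> unital_cleavage CV &
        categorical_connection C -> flat_cleavage CV].
Proof.
exists (@assocC R G X E C V rho); split.
- exact: assocC_cleavage.
- by move=> gamma p v; exact: assocC_cls.
- exact: assocC_unital.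
- exact: assocC_flat.
Qed.
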